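(* (a) Let $(R,L)$ be a standard protomesh such that $L$ is a complete meet semilattice and $(R,L)$ satisfies the JOP. Then there is a complete ortholattice $\widehat L$ and an order-isomorphism $i$ of $L$ with an order ideal of $\widehat L$. (b) Any weak right order of a rootoid $\mathcal R$ is order isomorphic to an order ideal of a complete ortholattice. (c) The weak right order of a Coxeter system $(W,S)$ is order isomorphic to an order ideal of a complete ortholattice.
   Context: Boolean rings are possibly non-unital rings in which $x^2=x$; they are ordered by $x\subseteq y$ iff $xy=x$, and one writes $x\cap y:=xy$, $\emptyset:=0$. A protomesh is a pair $(R,L)$ with $R$ a Boolean ring and $L\subseteq R$ a subset, ordered by the restriction of the order of $R$; it is standard if $0_R\in L$. A complete meet semilattice is a poset in which every non-empty subset has a meet (greatest lower bound). The protomesh $(R,L)$ satisfies the JOP (join orthogonality property) if, whenever $(x_i)_{i\in I}$ is a non-empty family in $L$ having a join $x$ in the poset $L$, and $y\in L$ satisfies $x_i\cap y=0$ for all $i$, then $x\cap y=0$. For a groupoid $G$ and $a,b\in \mathrm{ob}(G)$, write ${}_aG_b:=\mathrm{Hom}_G(b,a)$ and ${}_aG:=\bigcup_b {}_aG_b$. A protorootoid is a triple $\mathcal R=(G,\Lambda,N)$ with $G$ a groupoid, $\Lambda$ a functor from $G$ to the category of Boolean rings (with not necessarily unital ring homomorphisms), and $N$ a $1$-cocycle: $N(g)\in\Lambda(a)$ for $g\in{}_aG$, and $N(gh)=N(g)+\Lambda(g)(N(h))$ whenever $gh$ is defined. It is faithful if $N(g)=0$ implies that $g$ is an identity morphism.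 The weak right preorder at $a$ is the preorder on ${}_aG$ given by $x\leq y$ iff $N(x)\subseteq N(y)$; put ${}_a\mathcal L:=\{N(g)\mid g\in{}_aG\}\subseteq\Lambda(a)$. A rootoid is a faithful protorootoid such that for every $a\in\mathrm{ob}(G)$, the poset ${}_a\mathcal L$ is a complete meet semilattice and the protomesh $(\Lambda(a),{}_a\mathcal L)$ satisfies the JOP. For a rootoid, the weak right preorder at $a$ is a partial order, called the weak right order at $a$, and $g\mapsto N(g)$ is an order isomorphism ${}_aG\to{}_a\mathcal L$. The weak right order of a Coxeter system $(W,S)$ with length function $l$ is the partial order on $W$ with $x\leq y$ iff $l(y)=l(x)+l(x^{-1}y)$. An order ideal of a poset is a subset $I$ such that $y\le x\in I$ implies $y\in I$. A complete ortholattice is a complete lattice $V$ with an order-reversing map $z\mapsto z^{\complement}$ such that $(z^\complement)^\complement=z$, $z\wedge z^\complement=0_V$ and $z\vee z^\complement=1_V$ for all $z\in V$. *)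

(* Defs.v *)
From HB Require Import structures.
From mathcomp Require Import all_boot all_order all_algebra.
From mathcomp Require Import boolp classical_sets functions.

Set Implicit Arguments.
Unset Strict Implicit.
Unset Printing Implicit Defensive.

Import Order.TTheory GRing.Theory.
Local Open Scope classical_set_scope.

(* Not necessarily unital, hence not a [pzRingType]; commutativity follows
   from idempotence ([brmulC] below). *)
HB.mixin Record Zmodule_isBooleanRing R of GRing.Zmodule R := {
  brmul : R -> R -> R;
  brmulA : associative brmul;
  brmulDl : left_distributive brmul +%R;
  brmulDr : right_distributive brmul +%R;
  brmulxx : idempotent_op brmul
}.

#[short(type="booleanRingType")]
HB.structure Definition BooleanRing :=
  {R of GRing.Zmodule R & Zmodule_isBooleanRing R}.

Notation "x ∩ y" := (brmul x y) (at level 40, left associativity).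

Section BooleanRingOrder.
Variable R : booleanRingType.
Implicit Types x y z : R.

Lemma braddxx x : (x + x = 0)%R.
Proof.
have := brmulxx (x + x)%R; rewrite brmulDl !brmulDr brmulxx.
by move/(congr1 (+%R^~ (- (x + x))%R)); rewrite /= addrK subrr.
Qed.

Lemma brmulC : commutative (@brmul R).
Proof.
move=> x y; have := brmulxx (x + y)%R.
rewrite brmulDl !brmulDr !brmulxx -addrA => /addrI.
rewrite addrA -[X in _ = X]add0r => /addIr e.
by apply: (@addIr _ (y ∩ x)); rewrite e braddxx.
Qed.

Definition brle x y := x ∩ y == x.

Fact brle_refl : reflexive brle.
Proof. by move=> x; apply/eqP/brmulxx. Qed.

Fact brle_anti : antisymmetric brle.
Proof. by move=> x y /andP[/eqP xy /eqP]; rewrite brmulC xy. Qed.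

Fact brle_trans : transitive brle.
Proof.
by move=> y x z /eqP xy /eqP yz; apply/eqP; rewrite -xy -brmulA yz.
Qed.

Fact booleanRing_display : Order.disp_t. Proof. exact: (Order.Disp tt tt). Qed.

(* [(x <= y)%O] on a Boolean ring is the order written x ⊆ y in the
   mathematical literature. *)
HB.instance Definition _ := Order.Le_isPOrder.Build booleanRing_display R
  brle_refl brle_anti brle_trans.

End BooleanRingOrder.

Definition boolean_ring_hom (R R' : booleanRingType) (f : R -> R') : Prop :=
  {morph f : x y / (x + y)%R} /\ {morph f : x y / x ∩ y}.

(* A protomesh (R, L) is given by a Boolean ring [R] and [L : set R]; bounds,
   meets and joins below are taken in the poset [L], not in [R]. *)
Section Protomesh.
Variables (R : booleanRingType) (L : set R).
Implicit Types (A : set R) (x y : R).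

Definition standard_protomesh : Prop := L 0%R.

Definition is_meet_in A x : Prop :=
  [/\ L x, lbound A x & forall y, L y -> lbound A y -> (y <= x)%O].

Definition is_join_in A x : Prop :=
  [/\ L x, ubound A x & forall y, L y -> ubound A y -> (x <= y)%O].

Definition complete_meet_semilattice : Prop :=
  forall A, A `<=` L -> A !=set0 -> exists x, is_meet_in A x.

Definition JOP : Prop :=
  forall (I : Type) (x_ : I -> R) x y,
    [set: I] !=set0 -> (forall i, L (x_ i)) -> is_join_in (range x_) x ->
    L y -> (forall i, x_ i ∩ y = 0%R) -> x ∩ y = 0%R.

End Protomesh.

(* [hom b a] is the set of morphisms from b to a, so that [comp g h] is the
   composite written gh ("g after h"). *)
Record groupoid := Groupoid {
  ob :> Type;
  hom : ob -> ob -> Type;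
  idm : forall a, hom a a;
  comp : forall a b c, hom b a -> hom c b -> hom c a;
  invm : forall a b, hom b a -> hom a b;
  compA : forall a b c d (f : hom b a) (g : hom c b) (h : hom d c),
    comp f (comp g h) = comp (comp f g) h;
  comp1m : forall a b (f : hom b a), comp (idm a) f = f;
  compm1 : forall a b (f : hom b a), comp f (idm b) = f;
  compmV : forall a b (f : hom b a), comp f (invm f) = idm a;
  compVm : forall a b (f : hom b a), comp (invm f) f = idm b
}.

Record protorootoid := Protorootoid {
  gpd :> groupoid;
  Lam : ob gpd -> booleanRingType;
  Lam_map : forall a b : ob gpd, hom b a -> Lam b -> Lam a;
  Lam_hom : forall a b (g : hom b a), boolean_ring_hom (Lam_map g);
  Lam_id : forall a x, Lam_map (idm a) x = x;
  Lam_comp : forall a b c (g : hom b a) (h : hom c b) x,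
    Lam_map (comp g h) x = Lam_map g (Lam_map h x);
  coc : forall a b : ob gpd, hom b a -> Lam a;
  cocM : forall a b c (g : hom b a) (h : hom c b),
    coc (comp g h) = (coc g + Lam_map g (coc h))%R
}.

Section Rootoid.
Variable P : protorootoid.

Definition star (a : ob P) : Type := {b : ob P & hom b a}.

Definition N (a : ob P) (g : star a) : Lam a := coc (projT2 g).

(* Equality in [star a] also says that the domain of [g] is [a]. *)
Definition faithful : Prop :=
  forall (a : ob P) (g : star a), N g = 0%R -> g = existT (fun b => hom b a) a (idm a).

Definition weak_right_order (a : ob P) (g h : star a) : Prop := (N g <= N h)%O.

Definition weak_order_set (a : ob P) : set (Lam a) := range (@N a).
Arguments weak_order_set : clear implicits.

Definition rootoid : Prop :=
  faithful /\
  forall a : ob P, complete_meet_semilattice (weak_order_set a) /\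
                   JOP (weak_order_set a).

End Rootoid.

Section Coxeter.
Local Open Scope group_scope.
Variables (W : groupType) (S : set W).
Implicit Types (w x y : W) (n : nat).

Definition generates : Prop :=
  forall K : {pred W}, group_closed K -> (forall s, S s -> s \in K) ->
  forall w, w \in K.

Definition has_order w n : Prop :=
  [/\ (0 < n)%N, w ^+ n = 1 & forall m, (0 < m)%N -> w ^+ m = 1 -> (n <= m)%N].

(* The last conjunct says, through the universal property of presentations,
   that the generators S and the relations (st)^m(s,t) = 1, for s, t in S such
   that the order m(s,t) of st is finite, form a presentation of W. *)
Definition coxeter_system : Prop :=
  [/\ generates,
      forall s, S s -> has_order s 2
    & forall (H : groupType) (f : W -> H),
        (forall s t n, S s -> S t -> has_order (s * t) n ->
          (f s * f t) ^+ n = 1) ->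
        exists phi : {multiplicative W -> H}, forall s, S s -> phi s = f s].

Definition is_word w n : Prop :=
  exists s : n.-tuple W, (forall i, S (tnth s i)) /\
    \big[*%g/1]_(i < n) tnth s i = w.

(* The default value 0 is only used when [w] is not a product of elements of
   [S], which does not happen in a Coxeter system. *)
Definition len w : nat :=
  xget 0%N [set n | is_word w n /\ forall m, is_word w m -> (n <= m)%N].

Definition coxeter_weak_order x y : Prop := len y = (len x + len (x^-1 * y))%N.

End Coxeter.

Definition complete_lattice d (V : latticeType d) : Prop :=
  forall A : set V, infimums A !=set0 /\ supremums A !=set0.

Definition orthocomplementation d (V : tbLatticeType d) (c : V -> V) : Prop :=
  [/\ forall x y : V, (x <= y)%O -> (c y <= c x)%O,
      involutive c,
      forall z, (z `&` c z)%O = \bot%O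
    & forall z, (z `|` c z)%O = \top%O].

Definition order_ideal d (V : porderType d) (I : set V) : Prop :=
  forall x y : V, I x -> (y <= x)%O -> I y.

Definition order_isomorphism (T U : Type) (A : set T) (r : T -> T -> Prop)
    (B : set U) (r' : U -> U -> Prop) (f : T -> U) : Prop :=
  set_bij A B f /\ forall x y, A x -> A y -> (r x y <-> r' (f x) (f y)).

Definition iso_ideal_of_complete_ortholattice
    (T : Type) (A : set T) (r : T -> T -> Prop) : Prop :=
  exists (d : Order.disp_t) (V : tbLatticeType d) (c : V -> V)
         (I : set V) (i : T -> V),
    [/\ complete_lattice V, orthocomplementation c, order_ideal I
      & order_isomorphism A r I (fun u v : V => (u <= v)%O) i].

(* Main.v *)
(* Adjoin to the poset L a formal complement x^c of each x, and make doubled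
   points orthogonal as disjoint sets would be: x with y when x and y are
   disjoint, x with y^c when x <= y, and two complements never.  The
   biorthogonally closed sets form a complete ortholattice, in which x has the
   closure {z | z <= x}.  A closed set C below such a closure is a bounded
   subset of L; its join j satisfies z <= y or z disjoint from y as soon as all
   members of C do, the second case being the JOP, so that C = {z | z <= j}.

   For a Coxeter group the reflection cocycle w |-> inversions w, obtained from
   the presentation by mapping W to the semidirect product of (W -> bool) and W,
   gives the exchange condition.  Disjointness of x and y is
   l(x^-1 y) = l(x) + l(y).  Both the meets and the JOP come from one fact: the
   elements that lie below all of A and are orthogonal to all of B form an order
   ideal of bounded length in which us and ut have a common upper bound uw, with
   w the longest element of the parabolic subgroup of {s, t}, hence an ideal with
   a greatest element. *)

From HB Require Import structures.
From mathcomp Require Import all_boot all_order all_algebra.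
From mathcomp Require Import boolp classical_sets functions.
From mathcomp Require Import zify.
Require Import Defs.

Set Implicit Arguments.
Unset Strict Implicit.
Unset Printing Implicit Defensive.

Import Order.TTheory.

(** * Biorthogonally closed sets *)

(** A self-orthogonal point lies in every polar, so [perp_self] can stand in for irreflexivity. The
    least element of a poset will be such a point. *)
Record orthospace := Orthospace {
  point :> Type;
  perp : point -> point -> Prop;
  perp_sym : forall u v, perp u v -> perp v u;
  perp_self : forall u v, perp u u -> perp u v
}.

Section Biorthogonal.
Local Open Scope classical_set_scope.
Variable X : orthospace.
Implicit Types (A B : set X).

Definition polar A : set X := [set u | forall v, A v -> perp u v].

Lemma polarS A B : A `<=` B -> polar B `<=` polar A.
Proof. by move=> AB u uB v /AB; apply: uB. Qed.

Lemma sub_bipolar A : A `<=` polar (polar A).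
Proof. by move=> u Au v /(_ u Au) /perp_sym. Qed.

Lemma polarK A : polar (polar (polar A)) = polar A.
Proof.
by apply/seteqP; split; [apply/polarS/sub_bipolar | apply: sub_bipolar].
Qed.

Record biclosed := Biclosed {
  elements :> set X;
  bipolar_elements : polar (polar elements) = elements
}.
Implicit Types C D : biclosed.

HB.instance Definition _ := gen_eqMixin biclosed.
HB.instance Definition _ := gen_choiceMixin biclosed.

Lemma biclosed_eq C D : (C : set X) = D -> C = D.
Proof.
by case: C D => [C hC] [D hD] /= CD; case: _ / CD hD => hD; congr Biclosed.
Qed.

Definition bicl_le C D : bool := `[< C `<=` D >].

Fact bicl_le_refl : reflexive bicl_le.
Proof. by move=> C; apply/asboolP. Qed.

Fact bicl_le_anti : antisymmetric bicl_le.
Proof.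
by move=> C D /andP[/asboolP CD /asboolP DC]; apply/biclosed_eq/seteqP.
Qed.

Fact bicl_le_trans : transitive bicl_le.
Proof.
by move=> D C E /asboolP CD /asboolP DE; apply/asboolP/(subset_trans CD DE).
Qed.

Fact biclosed_display : Order.disp_t. Proof. exact: (Order.Disp tt tt). Qed.

HB.instance Definition _ := Order.Le_isPOrder.Build biclosed_display biclosed
  bicl_le_refl bicl_le_anti bicl_le_trans.

Lemma bicl_leE C D : (C <= D)%O = `[< C `<=` D >]. Proof. by []. Qed.

Definition bicl_polar A : biclosed := Biclosed (polarK A).
Definition bicl_join (F : set biclosed) : biclosed :=
  bicl_polar (polar (\bigcup_(C in F) C)).
(** De Morgan form, closed by [polarK] alone; [bicl_meetE] identifies it with the intersection. *)
Definition bicl_meet (F : set biclosed) : biclosed :=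
  bicl_polar (\bigcup_(C in F) bicl_polar C).

Lemma bicl_join_le F C : (bicl_join F <= C)%O <-> forall D, F D -> (D <= C)%O.
Proof.
split=> [/asboolP FC D FD | FC].
  apply/asboolP => u Du; apply/FC/sub_bipolar; by exists D.
apply/asboolP; rewrite /= -[elements C]bipolar_elements; apply/polarS/polarS.
by move=> u [D /FC /asboolP]; apply.
Qed.

Lemma bicl_meetE F : (bicl_meet F : set X) = \bigcap_(C in F) C.
Proof.
apply/seteqP; split=> [u uF C FC | u uF v [C FC]].
  by rewrite -[elements C]bipolar_elements => v vC; apply: uF; exists C.
by move=> /(_ u (uF C FC)) /perp_sym.
Qed.

Lemma bicl_le_meet F C : (C <= bicl_meet F)%O <-> forall D, F D -> (C <= D)%O.
Proof.
rewrite bicl_leE bicl_meetE; split=> [/asboolP CF D FD | CF].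
  by apply/asboolP => u /CF; apply.
by apply/asboolP => u Cu D /CF /asboolP; apply.
Qed.

Fact bicl_meetP C D E :
  (C <= bicl_meet [set D; E])%O = (C <= D)%O && (C <= E)%O.
Proof.
apply/idP/andP => [/bicl_le_meet h | [CD CE]]; first by split; apply: h; [left|right].
by apply/bicl_le_meet => _ [] ->.
Qed.

Fact bicl_joinP C D E :
  (bicl_join [set C; D] <= E)%O = (C <= E)%O && (D <= E)%O.
Proof.
apply/idP/andP => [/bicl_join_le h | [CD CE]]; first by split; apply: h; [left|right].
by apply/bicl_join_le => _ [] ->.
Qed.

HB.instance Definition _ := Order.POrder_MeetJoin_isLattice.Build
  biclosed_display biclosed bicl_meetP bicl_joinP.

Definition bicl_bot : biclosed := bicl_join set0.
Definition bicl_top : biclosed := bicl_meet set0.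

Fact bicl_le0 C : (bicl_bot <= C)%O. Proof. by apply/bicl_join_le. Qed.
Fact bicl_le1 C : (C <= bicl_top)%O. Proof. by apply/bicl_le_meet. Qed.

HB.instance Definition _ :=
  Order.hasBottom.Build biclosed_display biclosed bicl_le0.
HB.instance Definition _ :=
  Order.hasTop.Build biclosed_display biclosed bicl_le1.

Lemma biclosed_complete : complete_lattice biclosed.
Proof.
move=> F; split; [exists (bicl_meet F) | exists (bicl_join F)]; split.
- by move=> C FC; apply: (bicl_le_meet F _).1 FC.
- by move=> C FC; apply/bicl_le_meet.
- by move=> C FC; apply: (bicl_join_le F _).1 FC.
- by move=> C FC; apply/bicl_join_le.
Qed.

Lemma bicl_polar_orthocomplementation :
  orthocomplementation (fun C => bicl_polar C).
Proof.
have polK : involutive (fun C : biclosed => bicl_polar C).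
  by move=> C; apply/biclosed_eq/bipolar_elements.
have polS (C D : biclosed) : (C <= D)%O -> (bicl_polar D <= bicl_polar C)%O.
  by move=> /asboolP CD; apply/asboolP/polarS.
have meet0 (C : biclosed) : (C `&` bicl_polar C)%O = \bot%O.
  apply/le_anti/andP; split; last exact: le0x.
  apply/asboolP => u; rewrite [X in elements X u -> _]/Order.meet /= => uC.
  have : elements (bicl_meet [set C; bicl_polar C]) u by [].
  (* A common point of [C] and its polar is orthogonal to itself, hence to everything. *)
  rewrite bicl_meetE => h v _; apply: perp_self.
  by apply: (h (bicl_polar C) (or_intror erefl)); apply: (h C (or_introl erefl)).
split=> // C; apply/le_anti/andP; split; first exact: lex1.
(* The polar of the join lies below the polar of [C] and below its bipolar [C], hence below their
   meet. *)
have le0 : (bicl_polar (C `|` bicl_polar C)%O <= \bot)%O.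
  rewrite -(meet0 C) lexI -[X in (_ <= X)%O && _]polK.
  by apply/andP; split; apply/polS; [exact: leUr | exact: leUl].
rewrite -[X in (_ <= X)%O]polK -[X in (X <= _)%O]polK.
by apply/polS/(le_trans le0)/le0x.
Qed.

End Biorthogonal.

(** * Posets with an orthogonality relation *)

(** The common ground of protomeshes and Coxeter groups: [op_join] combines joins of bounded
    nonempty sets with the JOP for these joins. *)
Record orthogonality_poset := OrthogonalityPoset {
  opt :> Type;
  ople : opt -> opt -> Prop;
  orth : opt -> opt -> Prop;
  op0 : opt;
  ople_refl : forall x, ople x x;
  ople_anti : forall x y, ople x y -> ople y x -> x = y;
  ople_trans : forall y x z, ople x y -> ople y z -> ople x z;
  ople0 : forall x, ople op0 x;
  orth_sym : forall x y, orth x y -> orth y x;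
  orth0 : forall x, orth op0 x;
  orth_self : forall x, orth x x -> x = op0;
  orth_le : forall x y z, ople x y -> orth y z -> orth x z;
  op_join : forall (A : set opt) (b : opt), (exists x, A x) ->
    (forall x, A x -> ople x b) ->
    exists j, [/\ forall x, A x -> ople x j,
                  forall y, (forall x, A x -> ople x y) -> ople j y
                & forall y, (forall x, A x -> orth x y) -> orth j y]
}.

Section Embedding.
Local Open Scope classical_set_scope.
Variable P : orthogonality_poset.

(* [inr x] is the formal complement of [x]; two complements always meet, as they
   would in the unitization of a Boolean ring without unit. *)
Definition dperp (u v : P + P) : Prop :=
  match u, v with
  | inl x, inl y => orth x y
  | inl x, inr y | inr y, inl x => ople x y
  | inr _, inr _ => False
  end.

Lemma dperp_sym u v : dperp u v -> dperp v u.
Proof. by case: u v => [x|x] [y|y] //=; apply: orth_sym. Qed.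

Lemma dperp_self u v : dperp u u -> dperp u v.
Proof.
case: u v => [x|x] [y|y] //= /orth_self ->; [exact: orth0 | exact: ople0].
Qed.

Definition double : orthospace := Orthospace dperp_sym dperp_self.

Definition principal (x : P) : biclosed double :=
  bicl_polar (polar [set inl x : double]).

(** The point [inr x] is orthogonal to [inl x], and testing against it leaves only the [inl z] with
    [z] below [x]. Conversely, whatever is orthogonal to [inl x] is orthogonal to every such
    [inl z]. *)
Lemma principalE x (u : double) :
  elements (principal x) u <-> exists2 z, u = inl z & ople z x.
Proof.
split=> [ux | [z -> zx] [y|y] h].
- have : dperp u (inr x) by apply: ux => _ -> /=; apply: ople_refl.
  by case: u ux => // z _ zx; exists z.
- by apply: (orth_le zx); apply: orth_sym; apply: (h (inl x)).
- by apply: (ople_trans zx); apply: (h (inl x)).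
Qed.

Lemma principal_le x y : ople x y <-> (principal x <= principal y)%O.
Proof.
split=> [xy | /asboolP xy].
  apply/asboolP => u /principalE[z -> zx]; apply/principalE; exists z => //.
  exact: ople_trans zx xy.
have /xy/principalE[_ [<-] //] : elements (principal x) (inl x).
by apply/principalE; exists x => //; apply: ople_refl.
Qed.

Lemma principal_ideal : order_ideal (range principal).
Proof.
move=> _ C [b _ <-] /asboolP Cb.
have [] := @op_join P [set x | elements C (inl x)] b.
(* The least element is orthogonal to every doubled point, so every closed set contains it. *)
- by exists (op0 P); rewrite -[elements C]bipolar_elements => -[y|y] _;
    [exact: orth0 | exact: ople0].
- by move=> x /Cb/principalE[_ [<-]].
move=> j [jub jleast jorth]; exists j => //; apply: biclosed_eq.
apply/seteqP; split=> [u /principalE[z -> zj] | u Cu]; last first.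
  by have /principalE[z uz _] := Cb u Cu; apply/principalE; exists z => //;
    apply: jub; rewrite /= -uz.
rewrite -[elements C]bipolar_elements => -[y|y] h /=.
  by apply/(orth_le zj)/jorth => x Cx; apply/orth_sym/(h (inl x)).
by apply/(ople_trans zj)/jleast => x Cx; apply: (h (inl x)).
Qed.

Lemma orthogonality_poset_embedding :
  iso_ideal_of_complete_ortholattice [set: P] (@ople P).
Proof.
exists biclosed_display, (biclosed double), (fun C : biclosed double => bicl_polar C).
exists (range principal), principal; split.
- exact: biclosed_complete.
- exact: bicl_polar_orthocomplementation.
- exact: principal_ideal.
split; last by move=> x y _ _; apply: principal_le.
split=> // x y _ _ e; apply: ople_anti; apply/principal_le; rewrite e //.
Qed.

End Embedding.

Lemma iso_ideal_transport (T U : Type) (A : set T) (B : set U)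
    (r : T -> T -> Prop) (s : U -> U -> Prop) (h : U -> T) :
  iso_ideal_of_complete_ortholattice A r -> order_isomorphism B s A r h ->
  iso_ideal_of_complete_ortholattice B s.
Proof.
move=> [d [V [c [I [i [Vc Vo Ii [ibij ir]]]]]]] [hbij hs].
exists d, V, c, I, (i \o h); split=> //; split.
  exact: set_bij_comp hbij ibij.
by move=> x y Bx By; rewrite hs //; apply: ir; case: hbij => hAB _ _; apply: hAB.
Qed.

(** * Protomeshes and rootoids *)

Section ProtomeshEmbedding.
Local Open Scope classical_set_scope.
Variables (R : booleanRingType) (L : set R).
Hypotheses (L0 : standard_protomesh L) (Lmeet : complete_meet_semilattice L)
  (Ljop : JOP L).

Let T := {x : R | L x}.

(** The join is the meet of the upper bounds, a nonempty set because of [b]. The JOP is applied to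
    [A] as a family indexed by its own members. *)
Let Tjoin (A : set T) (b : T) : (exists x, A x) ->
    (forall x, A x -> (sval x <= sval b)%O) ->
    exists j : T, [/\ forall x, A x -> (sval x <= sval j)%O,
      forall y : T, (forall x, A x -> (sval x <= sval y)%O) ->
        (sval j <= sval y)%O
    & forall y : T, (forall x, A x -> sval x ∩ sval y = 0%R) ->
        sval j ∩ sval y = 0%R].
Proof.
move=> [a Aa] Ab.
pose ub : set R := [set y | L y /\ forall x, A x -> (sval x <= y)%O].
have [||j [Lj jlb jglb]] := @Lmeet ub.
- by move=> y [].
- by exists (sval b); split=> //; apply: svalP.
have jub x : A x -> (sval x <= j)%O.
  by move=> Ax; apply: jglb (svalP x) _ => y [_]; apply.
have jle y : L y -> (forall x, A x -> (sval x <= y)%O) -> (j <= y)%O.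
  by move=> Ly yub; apply: jlb.
exists (exist _ j Lj); split=> //= [y yub|[y Ly] /= hy]; first exact: jle (svalP y) yub.
apply: (Ljop (I := {x : T | A x}) (x_ := fun x => sval (sval x))) => //.
- by exists (exist _ a Aa).
- by move=> i; apply: svalP.
- split=> // [_ [[x Ax] _ <-] | z Lz zub]; first exact: jub.
  by apply: jle => // x Ax; apply: zub; exists (exist _ x Ax).
- by move=> [x Ax]; apply: hy.
Qed.

Lemma protomesh_embedding :
  iso_ideal_of_complete_ortholattice L (fun x y : R => (x <= y)%O).
Proof.
have br0 (x : R) : 0%R ∩ x = 0%R.
  by apply: (@GRing.addrI _ (0%R ∩ x)); rewrite -brmulDl !GRing.addr0.
have Tinj (x y : T) : sval x = sval y -> x = y by move/eq_sig_hprop; apply.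
have Tanti (x y : T) : (sval x <= sval y)%O -> (sval y <= sval x)%O -> x = y.
  by move=> xy yx; apply/Tinj/le_anti; rewrite xy.
have T0 (x : T) : ((0%R : R) <= sval x)%O by apply/eqP/br0.
have Tsym (x y : T) : sval x ∩ sval y = 0%R -> sval y ∩ sval x = 0%R.
  by rewrite brmulC.
have Tself (x : T) : sval x ∩ sval x = 0%R -> x = exist _ 0%R L0.
  by rewrite brmulxx => x0; apply: Tinj.
have Tle (x y z : T) : (sval x <= sval y)%O -> sval y ∩ sval z = 0%R ->
    sval x ∩ sval z = 0%R.
  by move=> /eqP <- yz; rewrite -brmulA yz brmulC br0.
pose P := @OrthogonalityPoset T (fun x y => (sval x <= sval y)%O)
  (fun x y => sval x ∩ sval y = 0%R) (exist _ 0%R L0)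
  (fun=> lexx _) Tanti (fun y x z => @le_trans _ _ _ _ _) T0 Tsym
  (fun x => br0 _) Tself Tle Tjoin.
(* The map from [R] to the subtype [T] takes the default value 0 outside [L], where nothing is
   compared. *)
apply: (iso_ideal_transport (h := fun x =>
  if pselect (L x) is left Lx then exist _ x Lx else exist _ 0%R L0)
  (orthogonality_poset_embedding P)).
have hE x (Lx : L x) : sval (if pselect (L x) is left Lx then exist L x Lx
    else exist L 0%R L0) = x by case: pselect.
split; last by move=> x y Lx Ly; rewrite /= !hE.
split=> [//|x y /set_mem Lx /set_mem Ly /(congr1 sval)|[x Lx] _]; last first.
  by exists x => //; apply: Tinj; rewrite hE.
by rewrite !hE.
Qed.

End ProtomeshEmbedding.

Section RootoidEmbedding.
Local Open Scope classical_set_scope.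
Local Open Scope ring_scope.
Variable P : protorootoid.

Lemma Lam_map0 (a b : ob P) (g : hom b a) : Lam_map g 0 = 0.
Proof.
have [gD _] := Lam_hom g.
by apply: (@GRing.addrI _ (Lam_map g 0)); rewrite -gD !GRing.addr0.
Qed.

Lemma coc_id (a : ob P) : coc (idm a) = 0.
Proof.
apply: (@GRing.addrI _ (coc (idm a))); rewrite GRing.addr0.
by rewrite -[X in _ = X](f_equal _ (comp1m (idm a))) cocM Lam_id.
Qed.

(** With h = gk, the cocycle identity gives Λ(g)(N(k)) = 0, so N(k) = 0, and faithfulness makes k an
    identity. *)
Lemma faithful_N_inj (a : ob P) : faithful P -> injective (@N P a).
Proof.
move=> Pf [b g] [c h] gh; pose k := comp (invm g) h.
have hE : h = comp g k by rewrite /k compA compmV comp1m.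
have k0 : coc k = 0.
  have : Lam_map g (coc k) = 0.
    apply: (@GRing.addrI _ (coc g)); rewrite -cocM -hE GRing.addr0.
    by rewrite -[LHS]/(N (existT _ c h)) -gh.
  move/(congr1 (Lam_map (invm g))).
  by rewrite -Lam_comp compVm Lam_id Lam_map0.
have := Pf b (existT _ c k) k0; rewrite {}hE; move: k {k0}.
(* The domains of [g] and [h] are only now identified, so the composite is written as a function of
   the pair formed by [c] and [k], which [E] can rewrite. *)
move=> k E; have -> : existT (fun b => hom b a) c (comp g k) =
  existT (fun b => hom b a) (projT1 (existT (fun c => hom c b) c k))
    (comp g (projT2 (existT (fun c => hom c b) c k))) by [].
by rewrite E /= compm1.
Qed.

Lemma rootoid_embedding (a : ob P) : rootoid P ->
  iso_ideal_of_complete_ortholattice [set: star a] (@weak_right_order P a).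
Proof.
move=> [Pf /(_ a) [Pmeet Pjop]].
apply: (iso_ideal_transport (h := @N P a) (protomesh_embedding _ Pmeet Pjop)).
  by exists (existT (fun b => hom b a) a (idm a)) => //; apply: coc_id.
split=> //; split=> [x _|x y _ _|//]; [by exists x | exact: faithful_N_inj].
Qed.

End RootoidEmbedding.

(** * Words and inversions in Coxeter groups *)

Section SemidirectProduct.
Local Open Scope group_scope.
Variable W : groupType.

(* Sets of elements of [W], with symmetric difference as the group law and [W]
   acting by conjugation, extended by [W]. *)
Definition set_sdprod : Type := ((W -> bool) * W)%type.
Implicit Types x y z : set_sdprod.

HB.instance Definition _ := Choice.on set_sdprod.

Definition sdp_one : set_sdprod := (fun=> false, 1).
Definition sdp_mul x y : set_sdprod :=
  (fun t => x.1 t (+) y.1 (t ^ x.2), x.2 * y.2).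
Definition sdp_inv x : set_sdprod := (fun t => x.1 (t ^ x.2^-1), x.2^-1).

Fact sdp_mulA : associative sdp_mul.
Proof.
move=> x y z; congr pair; last exact: mulgA.
by apply/funext => t /=; rewrite addbA conjgM.
Qed.

Fact sdp_mul1 : left_id sdp_one sdp_mul.
Proof.
move=> [f v]; congr pair; last exact: mul1g.
by apply/funext => t /=; rewrite conjg1.
Qed.

Fact sdp_mulx1 : right_id sdp_one sdp_mul.
Proof.
move=> [f v]; congr pair; last exact: mulg1.
by apply/funext => t /=; rewrite addbF.
Qed.

Fact sdp_mulVx : left_inverse sdp_one sdp_inv sdp_mul.
Proof.
move=> [f v]; congr pair; last exact: mulVg.
by apply/funext => t /=; rewrite addbb.
Qed.

Fact sdp_mulxV : right_inverse sdp_one sdp_inv sdp_mul.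
Proof.
move=> [f v]; congr pair; last exact: mulgV.
by apply/funext => t /=; rewrite conjgK addbb.
Qed.

HB.instance Definition _ := isGroup.Build set_sdprod
  sdp_mulA sdp_mul1 sdp_mulx1 sdp_mulVx sdp_mulxV.

Definition sdp_gen (s : W) : set_sdprod := (fun t => t == s, s).

(** The alternating word stst... with 2n letters produces the reflections (st)^j s, j < 2n, in this
    order; the first component keeps the parity of their multiplicities. *)
Lemma sdp_gen_expg (s t : W) n : s * s = 1 -> t * t = 1 ->
  (sdp_gen s * sdp_gen t) ^+ n =
  (fun r => \big[addb/false]_(0 <= j < n + n) (r == (s * t) ^+ j * s),
   (s * t) ^+ n) :> set_sdprod.
Proof.
move=> ss tt.
have sV : s^-1 = s by apply: mulg1_eq.
have tV : t^-1 = t by apply: mulg1_eq.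
elim: n => [|n IHn].
  by rewrite !expg0; congr pair; apply/funext => r; rewrite big_nil.
rewrite expgSr {}IHn; congr pair; last by rewrite /= -expgSr.
apply/funext => r /=; rewrite addnS addSn !big_nat_recr //= -addbA.
set p := (s * t) ^+ n.
(* The dihedral relation: conjugation by [s] inverts st and its powers. *)
have sp : s * p^-1 = p * s.
  rewrite /p -expVgn invgM sV tV; elim: n {p} => [|n IHn];
    first by rewrite !expg0 mul1g mulg1.
  by rewrite expgSr mulgA IHn (expgSr _ n) -!mulgA.
have conjE (x q : W) : (r ^ q == x) = (r == q * (x * q^-1)).
  apply/eqP/eqP=> [<-|->]; rewrite conjgE.
    by rewrite -!mulgA mulgV mulg1 mulVKg.
  by rewrite -!mulgA mulVg mulg1 mulKg.
congr (_ (+) _); rewrite -conjgM !conjE; congr (_ (+) _).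
  by rewrite sp expgnDr mulgA.
by rewrite invgM sV sp -addSn expgnDr expgSr -/p !mulgA.
Qed.

(** When (st)^n = 1, the list of 2n reflections is a list of length n written twice, so all parities
    vanish. *)
Lemma sdp_gen_rel (s t : W) n : s * s = 1 -> t * t = 1 ->
  (s * t) ^+ n = 1 -> (sdp_gen s * sdp_gen t) ^+ n = 1 :> set_sdprod.
Proof.
move=> ss tt stn; rewrite sdp_gen_expg // stn; congr pair.
apply/funext => r; rewrite (big_cat_nat (n := n)) ?leq_addr //=.
rewrite -[X in _ (+) \big[_/_]_(X <= _ < _) _]add0n big_addn addnK.
under [X in _ (+) X]eq_bigr do rewrite expgnDr stn mulg1.
by rewrite addbb.
Qed.

End SemidirectProduct.

Section Words.
Local Open Scope group_scope.
Variables (W : groupType) (J : set W).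
Implicit Types (v w : W) (m n : nat).

Lemma is_word0 w : is_word J w 0 <-> w = 1.
Proof.
split=> [[s [_ <-]]|->]; first by rewrite big_ord0.
by exists [tuple]; split=> [[]//|]; rewrite big_ord0.
Qed.

Lemma is_wordS w n :
  is_word J w n.+1 <-> exists s v, [/\ J s, is_word J v n & w = s * v].
Proof.
split=> [[s [Js <-]]|[s [_ [Js [u [Ju <-]] ->]]]].
  exists (thead s), (\prod_(i < n) tnth (behead_tuple s) i); split.
  - by rewrite /thead; apply: Js.
  - exists (behead_tuple s); split=> // i.
    by rewrite tnth_behead; apply: Js.
  - rewrite big_ord_recl; congr (_ * _).
    by apply: eq_bigr => i _; rewrite tnth_behead; congr tnth;
      apply/val_inj; rewrite /= inordK ?ltnS.
exists [tuple of s :: u]; split=> [i|].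
  by case: (unliftP ord0 i) => [j|] ->; rewrite ?tnthS ?tnth0.
by rewrite big_ord_recl tnth0; under eq_bigr do rewrite tnthS.
Qed.

Lemma is_word1 w : J w -> is_word J w 1.
Proof.
by move=> Jw; apply/is_wordS; exists w, 1; rewrite mulg1; split=> //; apply/is_word0.
Qed.

Lemma is_wordM v w m n :
  is_word J v m -> is_word J w n -> is_word J (v * w) (m + n).
Proof.
elim: m v => [|m IHm] v; first by move=> /is_word0-> ?; rewrite mul1g.
move=> /is_wordS[s [u [Js Ju ->]]] Jw; apply/is_wordS.
by exists s, (u * w); rewrite mulgA; split=> //; apply: IHm.
Qed.

Hypothesis JV : forall s, J s -> s^-1 = s.

Lemma is_wordV w n : is_word J w n -> is_word J w^-1 n.
Proof.
elim: n w => [|n IHn] w; first by move=> /is_word0->; rewrite invg1; apply/is_word0.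
move=> /is_wordS[s [v [Js Jv ->]]]; rewrite invgM (JV Js) -addn1.
exact: is_wordM (IHn _ Jv) (is_word1 Js).
Qed.

End Words.

(* [lia] compares atoms syntactically, but products in [W] may be elaborated
   along different, convertible, structure inheritance paths. *)
Ltac len_lia :=
  repeat match goal with H : context [len _ _] |- _ => revert H end;
  repeat match goal with |- context [len ?S ?x] =>
    let k := fresh "k" in move: (len S x) => k end;
  lia.

Section WeakOrder.
Local Open Scope group_scope.
Variables (W : groupType) (S : set W).
Hypothesis WS : coxeter_system S.
Implicit Types (s t u v w x y z : W) (n : nat).

Lemma gen_sqr s : S s -> s * s = 1.
Proof. by case: WS => _ + _ Ss => /(_ s Ss) [_]; rewrite expg2. Qed.

Lemma gen_inv s : S s -> s^-1 = s.
Proof. by move=> /gen_sqr; apply: mulg1_eq. Qed.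

Lemma ex_word w : exists n, is_word S w n.
Proof.
pose K : {pred W} := [pred w | `[< exists n, is_word S w n >]].
case: WS => /(_ K) gen _ _; apply/asboolP/gen.
  split=> [|u v /asboolP[m Su] /asboolP[n Sv]]; apply/asboolP.
    by exists 0; apply/is_word0.
  by exists (m + n); apply: is_wordM Su _; apply: is_wordV Sv; apply: gen_inv.
by move=> s Ss; apply/asboolP; exists 1%N; apply: is_word1.
Qed.

(** The first component of the morphism into the semidirect product is the cocycle, once the second
    component is known, by induction on words, to be the identity of [W]. *)
Lemma ex_inversions : exists I : W -> W -> bool,
  (forall s t, S s -> I s t = (t == s)) /\
  (forall v w t, I (v * w) t = I v t (+) I w (t ^ v)).
Proof.
case: WS => _ _ /(_ (set_sdprod W) (@sdp_gen W)) [|phi phiS].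
  by move=> s t n Ss St [_ stn _]; apply: sdp_gen_rel stn; apply: gen_sqr.
have phi1 : phi 1 = 1 by apply: (@mulgI _ (phi 1)); rewrite -gmulfM !mulg1.
have phi2 w : (phi w).2 = w.
  have [n] := ex_word w; elim: n w => [|n IHn] w; first by move=> /is_word0->; rewrite phi1.
  by move=> /is_wordS[s [v [Ss Sv ->]]]; rewrite gmulfM phiS //= IHn.
exists (fun w => (phi w).1); split=> [s t Ss|v w t]; first by rewrite phiS.
by rewrite gmulfM /= phi2.
Qed.

Definition inversions : W -> W -> bool := sval (cid ex_inversions).

Lemma inversions_gen s t : S s -> inversions s t = (t == s).
Proof. by case: (svalP (cid ex_inversions)) => + _; apply. Qed.

Lemma inversionsM v w t :
  inversions (v * w) t = inversions v t (+) inversions w (t ^ v).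
Proof. by case: (svalP (cid ex_inversions)) => _; apply. Qed.

Lemma inversions1 t : inversions 1 t = false.
Proof. by have := inversionsM 1 1 t; rewrite mulg1 conjg1 addbb. Qed.

Lemma inversions_genM s w : S s -> inversions (s * w) s = ~~ inversions w s.
Proof.
by move=> Ss; rewrite inversionsM inversions_gen // eqxx conjgE mulKg.
Qed.

Lemma lenP w : is_word S w (len S w) /\ forall n, is_word S w n -> len S w <= n.
Proof.
rewrite /len; case: xgetP => [n _ //|noword].
have ex : exists n, `[< is_word S w n >].
  by have [n Sw] := ex_word w; exists n; apply/asboolP.
case: (ex_minnP ex) => n /asboolP Sw nmin; case: (noword n); split=> // m Sm.
exact/nmin/asboolP.
Qed.

Lemma len_word w : is_word S w (len S w). Proof. by have [] := lenP w. Qed.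

Lemma len_le w n : is_word S w n -> len S w <= n.
Proof. by have [_] := lenP w; apply. Qed.

Lemma len1 : len S 1 = 0.
Proof. by apply/eqP; rewrite -leqn0; apply/len_le/is_word0. Qed.

Lemma len_eq0 w : len S w = 0 -> w = 1.
Proof. by move=> w0; apply/(is_word0 S); rewrite -w0; apply: len_word. Qed.

Lemma lenM_le v w : len S (v * w) <= len S v + len S w.
Proof. exact/len_le/is_wordM/len_word/len_word. Qed.

Lemma lenV w : len S w^-1 = len S w.
Proof.
have le v : len S v^-1 <= len S v.
  by apply/len_le/is_wordV; [exact: gen_inv | exact: len_word].
by apply/eqP; rewrite eqn_leq le -{1}(invgK w) le.
Qed.

(** Strong exchange: if w = sv, then either t = s cancels the first letter, or [t ^ s] is an
    inversion of v and tw = s(t^s)v, where induction deletes a letter of v. Keeping the letters in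
    [J] makes this usable inside parabolic subgroups. *)
Lemma deletion (J : set W) w n t : (J `<=` S)%classic ->
  is_word J w n -> inversions w t -> exists2 k, n = k.+1 & is_word J (t * w) k.
Proof.
move=> JS; elim: n w t => [|n IHn] w t; first by move=> /is_word0->; rewrite inversions1.
move=> /is_wordS[s [v [Js Jv ->]]]; have Ss := JS _ Js.
rewrite inversionsM inversions_gen //; case: eqVneq => [-> _|_ /=].
  by exists n => //; rewrite mulgA gen_sqr // mul1g.
move=> /(IHn _ _ Jv)[k -> Jk]; exists k.+1 => //; apply/is_wordS.
by exists s, (t ^ s * v); split=> //; rewrite conjgE !mulgA mulgV mul1g.
Qed.

Lemma inversion_len w t : inversions w t -> len S (t * w) < len S w.
Proof.
by move=> /(deletion (fun _ => id) (len_word w))[k -> /len_le].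
Qed.

(** Exactly one of w and sw has the inversion s, and exchange shortens that one. *)
Lemma len_genM s w : S s ->
  if inversions w s then len S w = (len S (s * w)).+1
  else len S (s * w) = (len S w).+1.
Proof.
move=> Ss; have le v : len S (s * v) <= (len S v).+1.
  by rewrite -[X in _ <= X]add1n (leq_trans (lenM_le _ _)) // leq_add2r len_le //;
    apply: is_word1.
have ssw : s * (s * w) = w by rewrite mulgA gen_sqr // mul1g.
case: ifPn => [/inversion_len lt | ]; last rewrite -inversions_genM //.
  by apply/eqP; rewrite eqn_leq lt -{1}ssw le.
by move=> /inversion_len; rewrite ssw => lt; apply/eqP; rewrite eqn_leq lt le.
Qed.

(** * Parabolic subgroups and the weak order *)

Section Parabolic.
Variable J : set W.
Hypothesis JS : (J `<=` S)%classic.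

Definition parabolic w := exists n, is_word J w n.

Lemma parabolic1 : parabolic 1.
Proof. by exists 0; apply/is_word0. Qed.

Lemma parabolicM v w : parabolic v -> parabolic w -> parabolic (v * w).
Proof. by move=> [m Jv] [n Jw]; exists (m + n); apply: is_wordM. Qed.

Lemma parabolicV w : parabolic w -> parabolic w^-1.
Proof. by move=> [n Jw]; exists n; apply: is_wordV Jw => s /JS/gen_inv. Qed.

Lemma parabolic_gen s : J s -> parabolic s.
Proof. by exists 1%N; apply: is_word1. Qed.

(** Induction along reduced words: if the first letter is already an inversion of the rest, deletion
    gives a shorter word in [J] for the same element. *)
Lemma parabolic_ind (Q : W -> Prop) : Q 1 ->
  (forall s x, J s -> parabolic x -> ~~ inversions x s -> Q x -> Q (s * x)) ->
  forall x, parabolic x -> Q x.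
Proof.
move=> Q1 QM x [n]; elim/ltn_ind: n x => -[|n] IHn x; first by move=> /is_word0->.
move=> /is_wordS[s [y [Js Jy ->]]]; have [ys|ys] := boolP (inversions y s).
  have [k nk Jk] := deletion JS Jy ys; apply: (IHn k _ _ Jk); lia.
by apply: QM => //; [exists n | apply: IHn Jy].
Qed.

Lemma parabolic_descent x : parabolic x -> x = 1 \/ exists2 s, J s & inversions x s.
Proof.
move: x; apply: parabolic_ind => [|s x Js _ xs _]; first by left.
by right; exists s => //; rewrite inversions_genM //; apply: JS.
Qed.

(** Take [v] of least length in the coset W_J u. An inversion [s ^ y] of [v] would give a shorter
    element of that coset, so s lengthens yv whenever it lengthens y. *)
Lemma parabolic_coset u : exists x v, [/\ parabolic x, u = x * v
  & forall y, parabolic y -> len S (y * v) = len S y + len S v].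
Proof.
pose C n := `[< exists x v, [/\ parabolic x, u = x * v & len S v = n] >].
have exC : exists n, C n.
  exists (len S u); apply/asboolP; exists 1, u; rewrite mul1g; split=> //.
  exact: parabolic1.
case: (ex_minnP exC) => _ /asboolP[x [v [Jx uE <-]]] vmin.
exists x, v; split=> //; apply: parabolic_ind => [|s y Js Jy ys IH].
  by rewrite mul1g len1.
have Ss := JS Js; have [vs|vs] := boolP (inversions v (s ^ y)).
  have Jsy : parabolic (s ^ y).
    apply/parabolicM/parabolicM/Jy/parabolic_gen/Js; exact: parabolicV.
  have := inversion_len vs; rewrite ltnNge vmin //; apply/asboolP.
  exists (x * (s ^ y)^-1), (s ^ y * v); split=> //.
    exact/parabolicM/parabolicV.
  by rewrite uE [RHS]mulgA mulgVK.
have yvs : ~~ inversions (y * v) s by rewrite inversionsM (negbTE ys) (negbTE vs).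
have := len_genM (y * v) Ss; have := len_genM y Ss.
by rewrite (negbTE ys) (negbTE yvs) IH mulgA => -> ->.
Qed.

(** In the factorization u = xv of [parabolic_coset], a left descent of x in [J] would be one of u;
    hence x = 1. *)
Lemma parabolic_lenM u : (forall s, J s -> ~~ inversions u s) ->
  forall x, parabolic x -> len S (x * u) = len S x + len S u.
Proof.
have [x [v [Jx uE vmin]]] := parabolic_coset u => umin.
have [x1|[s Js xs]] := parabolic_descent Jx.
  by rewrite uE x1 mul1g.
have Jsx : parabolic (s * x) by apply/parabolicM/Jx/parabolic_gen.
have suE : s * u = (s * x) * v by rewrite uE mulgA.
have := len_genM x (JS Js); have := len_genM u (JS Js).
rewrite xs (negbTE (umin s Js)) suE [in len S u]uE !vmin //; lia.
Qed.

(** Since s is an inversion of w = x(x^-1 w) but not of x, [s ^ x] is one of x^-1 w, so passing from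
    x to sx shortens the remaining factor. A [w] in W_J is thus its longest element. *)
Lemma parabolic_le w : (forall s, J s -> inversions w s) ->
  forall x, parabolic x -> coxeter_weak_order S x w.
Proof.
move=> wJ; apply: parabolic_ind => [|s x Js _ xs]; rewrite /coxeter_weak_order.
  by rewrite len1 invg1 mul1g.
move=> IH; have Ss := JS Js.
have := wJ s Js; rewrite -{1}(mulVKg x w) inversionsM (negbTE xs) /=.
move=> /inversion_len.
have <- : (s * x)^-1 * w = s ^ x * (x^-1 * w).
  by rewrite conjgE invgM (gen_inv Ss) -!mulgA mulVKg.
have := lenM_le (s * x) ((s * x)^-1 * w); rewrite mulVKg.
have := len_genM x Ss; rewrite (negbTE xs). len_lia.
Qed.

End Parabolic.

(** * The weak order and its orthogonality relation *)

Local Notation "x <=W y" := (coxeter_weak_order S x y) (at level 70).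

Lemma weak_refl x : x <=W x.
Proof. by rewrite /coxeter_weak_order mulVg len1 addn0. Qed.

Lemma weak1 x : 1 <=W x.
Proof. by rewrite /coxeter_weak_order len1 invg1 mul1g. Qed.

Lemma weak_anti x y : x <=W y -> y <=W x -> x = y.
Proof.
rewrite /coxeter_weak_order => xy yx.
have /len_eq0 : len S (x^-1 * y) = 0 by len_lia.
by move/(congr1 (fun z => x * z)); rewrite mulVKg mulg1.
Qed.

Lemma weak_trans y x z : x <=W y -> y <=W z -> x <=W z.
Proof.
rewrite /coxeter_weak_order => xy yz.
have := lenM_le (x^-1 * y) (y^-1 * z); have := lenM_le x (x^-1 * z).
rewrite -(mulgA x^-1) !mulVKg; len_lia.
Qed.

Lemma weak_len x y : x <=W y -> len S x <= len S y.
Proof. by rewrite /coxeter_weak_order => ->; apply: leq_addr. Qed.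

Lemma weak_mul u w : len S (u * w) = len S u + len S w -> u <=W u * w.
Proof. by rewrite /coxeter_weak_order mulKg. Qed.

(* Equivalently, [x] and [y] have no inversion in common. *)
Definition weak_orth x y : Prop := len S (x^-1 * y) = len S x + len S y.

Lemma weak_orth_sym x y : weak_orth x y -> weak_orth y x.
Proof. by rewrite /weak_orth -lenV invgM invgK addnC. Qed.

Lemma weak_orth1 x : weak_orth 1 x.
Proof. by rewrite /weak_orth len1 invg1 mul1g. Qed.

Lemma weak_orth_self x : weak_orth x x -> x = 1.
Proof. by rewrite /weak_orth mulVg len1 => ?; apply: len_eq0; len_lia. Qed.

(** For the distance l(x^-1 y), the first hypothesis puts x on a geodesic from 1 to y, and the
    second puts 1 on a geodesic from y to z; hence 1 lies on a geodesic from x to z. *)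
Lemma weak_orth_le x y z : x <=W y -> weak_orth y z -> weak_orth x z.
Proof.
rewrite /coxeter_weak_order /weak_orth => xy yz.
have := lenM_le (y^-1 * x) (x^-1 * z); have := lenM_le x^-1 z.
rewrite -(mulgA y^-1) mulVKg lenV -(lenV (y^-1 * x)) invgM invgK; len_lia.
Qed.

(** * Greatest elements of bounded ideals, and joins *)

Lemma weak_cover u v : u <=W v -> u <> v ->
  exists s, [/\ S s, len S (u * s) = (len S u).+1 & u * s <=W v].
Proof.
rewrite /coxeter_weak_order => uv u_v; have := len_word (u^-1 * v).
case lE : (len S (u^-1 * v)) => [|n].
  by case: u_v; rewrite -(mulVKg u v) (len_eq0 lE) mulg1.
move=> /is_wordS[s [w [Ss /len_le Sw wE]]]; exists s.
have vE : (u * s)^-1 * v = w by rewrite invgM -mulgA wE mulKg.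
have := lenM_le (u * s) ((u * s)^-1 * v); have := lenM_le u s.
have := len_le (is_word1 Ss); rewrite mulVKg vE => ? ? ?; split=> //; len_lia.
Qed.

(* Newman's lemma for the relation [u -> u * s] inside [D]. *)
Lemma bounded_ideal_max (D : set W) (n : nat) :
  (exists x, D x) -> (forall x y, x <=W y -> D y -> D x) ->
  (forall x, D x -> len S x <= n) ->
  (forall u s t, S s -> S t -> len S (u * s) = (len S u).+1 ->
    len S (u * t) = (len S u).+1 -> D (u * s) -> D (u * t) ->
    exists p, [/\ D p, u * s <=W p & u * t <=W p]) ->
  exists z, D z /\ forall x, D x -> x <=W z.
Proof.
move=> [x0 Dx0] Dle Dn Dconf.
(* Localized above [u] for an induction on the room [n - len S u]; the case u = 1 is the claim. *)
suff max m : forall u, D u -> n - len S u <= m ->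
    exists z, D z /\ forall x, D x -> u <=W x -> x <=W z.
  have [z [Dz zmax]] := max _ 1 (Dle _ _ (weak1 x0) Dx0) (leqnn _).
  by exists z; split=> // x /zmax; apply; apply: weak1.
have weak_gen u s : S s -> len S (u * s) = (len S u).+1 -> u <=W u * s.
  move=> Ss us; apply: weak_mul; have := lenM_le u s.
  have := len_le (is_word1 Ss); len_lia.
elim: m => [|m IHm] u Du um.
  exists u; split=> // x Dx ux; have [->|/eqP] := eqVneq u x; first exact: weak_refl.
  by move=> /(weak_cover ux)[s [Ss us /Dle/(_ Dx)/Dn]]; len_lia.
have [[s [Ss us Dus]]|no] := pselect (exists s,
    [/\ S s, len S (u * s) = (len S u).+1 & D (u * s)]); last first.
  exists u; split=> // x Dx ux; have [->|/eqP] := eqVneq u x; first exact: weak_refl.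
  move=> /(weak_cover ux)[s [Ss us usx]]; case: no; exists s; split=> //.
  exact: Dle usx Dx.
have [|z [Dz zmax]] := IHm _ Dus; first by len_lia.
exists z; split=> // x Dx ux; have [<-|/eqP] := eqVneq u x.
  exact: weak_trans (weak_gen _ _ Ss us) (zmax _ Dus (weak_refl _)).
move=> /(weak_cover ux)[t [St ut utx]]; have Dut := Dle _ _ utx Dx.
have [|y [Dy ymax]] := IHm _ Dut; first by len_lia.
(* [z] and [y] are greatest in [D] above us and above ut. Both dominate [p], so each lies above the
   other. *)
have [p [Dp usp utp]] := Dconf u s t Ss St us ut Dus Dut.
have utz : u * t <=W z by apply: weak_trans utp (zmax _ Dp usp).
suff <- : y = z by apply: ymax.
apply: weak_anti (ymax _ Dz utz); apply: zmax => //.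
exact: weak_trans usp (ymax _ Dp utp).
Qed.

(** Split u^-1 a = wv along W_J. As us lies below a, s is a left descent of wv, hence of w because
    lengths add. The bound [a] is what provides a longest element of W_J. *)
Lemma weak_parabolic_join (J : set W) u a : (J `<=` S)%classic ->
  (forall s, J s -> len S (u * s) = (len S u).+1 /\ u * s <=W a) -> u <=W a ->
  exists w, [/\ parabolic J w, forall s, J s -> inversions w s,
    len S (u * w) = len S u + len S w & u * w <=W a].
Proof.
move=> JS uJ; have [w [v [Jw bE vmin]]] := parabolic_coset JS (u^-1 * a).
rewrite /coxeter_weak_order => ua; exists w.
have wv := vmin _ Jw; have := lenM_le u w; have := lenM_le (u * w) v.
have -> : u * w * v = a by rewrite -mulgA -bE mulVKg.
have vE : (u * w)^-1 * a = v by rewrite invgM -mulgA bE mulKg.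
rewrite vE => ? ?; move: ua; rewrite bE => ua.
split; [by [] | | len_lia | len_lia] => s Js.
have [us] := uJ s Js; have Ss := JS _ Js.
rewrite /coxeter_weak_order invgM -mulgA bE (gen_inv Ss).
have -> : s * (w * v) = (s * w) * v by rewrite mulgA.
rewrite vmin; last exact/parabolicM/Jw/parabolic_gen.
by have := len_genM w Ss; case: ifP => // _; len_lia.
Qed.

Lemma weak_max_below_orth (A B : set W) : (exists a, A a) ->
  exists z, [/\ forall a, A a -> z <=W a, forall b, B b -> weak_orth z b
    & forall x, (forall a, A a -> x <=W a) -> (forall b, B b -> weak_orth x b) ->
        x <=W z].
Proof.
move=> [a0 Aa0].
pose D : set W := [set x | (forall a, A a -> x <=W a) /\
    (forall b, B b -> weak_orth x b)]%classic.
have [||x [xA _]||z [[zA zB] zmax]] := @bounded_ideal_max D (len S a0).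
- by exists 1; split=> x _; [apply: weak1 | apply: weak_orth1].
- move=> x y xy [yA yB]; split=> [a /yA|b /yB]; first exact: weak_trans.
  exact: weak_orth_le.
- exact: weak_len (xA a0 Aa0).
- move=> u s t Ss St us ut [usA usB] [utA utB].
  pose J : set W := [set s; t]%classic.
  have JS : (J `<=` S)%classic by move=> _ [] ->.
  have uJ r : J r -> len S (u * r) = (len S u).+1 by case=> ->.
  have uA a r : A a -> J r -> u * r <=W a by move=> Aa [] ->; [apply: usA | apply: utA].
  have uB b r : B b -> J r -> weak_orth (u * r) b.
    by move=> Bb [] ->; [apply: usB | apply: utB].
  have u_ur r : J r -> u <=W u * r.
    move=> Jr; apply: weak_mul; rewrite uJ //; have := lenM_le u r.
    have := len_le (is_word1 (JS _ Jr)); rewrite uJ //; len_lia.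
  have Js : J s by left.
  have join a (Aa : A a) := weak_parabolic_join JS
    (fun r Jr => conj (uJ r Jr) (uA a r Aa Jr)) (weak_trans (u_ur s Js) (uA a s Aa Js)).
  have [w [Jw wJ uw _]] := join a0 Aa0; have Jw' := parabolicV JS Jw.
  have le_uw r : J r -> u * r <=W u * w.
    move=> Jr; have Sr := JS _ Jr; rewrite /coxeter_weak_order uw uJ //.
    have -> : (u * r)^-1 * (u * w) = r * w by rewrite invgM -mulgA mulKg gen_inv.
    by have := len_genM w Sr; rewrite wJ // => ->; len_lia.
  exists (u * w); split;
    [split=> [a Aa|b Bb] | exact: le_uw | by apply: le_uw; right].
    (* Each [a] yields its own longest element of the parabolic subgroup; all of them coincide. *)
    have [w' [Jw'' wJ' _ uw'a]] := join a Aa; suff -> : w = w' by [].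
    by apply: weak_anti; [exact: (parabolic_le JS wJ') | exact: (parabolic_le JS wJ)].
  have ub : len S (u^-1 * b) = len S u + len S b.
    exact: weak_orth_le (u_ur s Js) (uB b s Bb Js).
  (* Orthogonality of ur to b says that r lengthens u^-1 b; therefore w^-1 adds its full length to
     it. *)
  have ubJ r : J r -> ~~ inversions (u^-1 * b) r.
    move=> Jr; have Sr := JS _ Jr; have := len_genM (u^-1 * b) Sr.
    have := uB b r Bb Jr; rewrite /weak_orth invgM -mulgA (gen_inv Sr) (uJ r Jr).
    by case: ifP => // _; len_lia.
  have := parabolic_lenM JS ubJ Jw'; rewrite lenV /weak_orth invgM -mulgA.
  len_lia.
exists z; split=> // x xA xB; exact: zmax.
Qed.

Lemma weak_join (A : set W) b : (exists x, A x) -> (forall x, A x -> x <=W b) ->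
  exists j, [/\ forall x, A x -> x <=W j,
                forall y, (forall x, A x -> x <=W y) -> j <=W y
              & forall y, (forall x, A x -> weak_orth x y) -> weak_orth j y].
Proof.
move=> _ Ab; pose U : set W := [set y | forall x, A x -> x <=W y]%classic.
have Ub : exists y, U y by exists b.
have [j [jU _ jmax]] := weak_max_below_orth set0 Ub.
have Aj x : A x -> x <=W j by move=> Ax; apply: jmax => // y; apply.
exists j; split=> // y Ay.
(* [z] is greatest among the elements orthogonal to [y] and below all upper bounds of [A]. It
   dominates [A], so it lies above [j], which inherits orthogonality to [y]. *)
have [z [zU zy zmax]] := weak_max_below_orth [set y] Ub.
apply: (weak_orth_le _ (zy y erefl)); apply: jU => x Ax.
by apply: zmax => [a|_ ->]; [apply | apply: Ay].
Qed.

Lemma coxeter_embedding :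
  iso_ideal_of_complete_ortholattice [set: W]%classic (coxeter_weak_order S).
Proof.
exact: (orthogonality_poset_embedding (@OrthogonalityPoset W
  (coxeter_weak_order S) weak_orth 1 weak_refl weak_anti weak_trans weak1
  weak_orth_sym weak_orth1 weak_orth_self weak_orth_le weak_join)).
Qed.

End WeakOrder.

Theorem corollary10p8 :
  (forall (R : booleanRingType) (L : set R),
     standard_protomesh L -> complete_meet_semilattice L -> JOP L ->
     iso_ideal_of_complete_ortholattice L (fun x y : R => (x <= y)%O))
  /\
  (forall P : protorootoid, rootoid P -> forall a : ob P,
     iso_ideal_of_complete_ortholattice
       [set: star a]%classic (@weak_right_order P a))
  /\
  (forall (W : groupType) (S : set W), coxeter_system S ->
     iso_ideal_of_complete_ortholattice [set: W]%classic (coxeter_weak_order S)).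
Proof.
split; first exact: protomesh_embedding.
split=> [P RP a|W S WS]; first exact: rootoid_embedding.
exact: coxeter_embedding.
Qed.
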